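(* Suppose $X$ is sub-Gaussian with constant $C_1$. Then there is a constant $c>0$ depending only on $C_1$ such that for all $y>0$ satisfying $$\frac{1}{n(y\wedge1)}\sum_{k>d}\frac{\lambda_k}{\lambda_d-\lambda_k+y\lambda_d}\le\frac1{2C_3^2}$$ we have $$\mathbb P\big(\hat\lambda_d-\lambda_d>y\lambda_d\big)\le e^{1-cn(y\wedge y^2)}.$$ Moreover, for all $y>0$ satisfying $$\frac{1}{n(y\wedge1)}\sum_{j<d}\frac{\lambda_j}{\lambda_j-\lambda_d+y\lambda_d}\le\frac1{2C_3^2}$$ we have $$\mathbb P\big(\hat\lambda_d-\lambda_d<-y\lambda_d\big)\le e^{1-cn(y\wedge y^2)}.$$
   Context: Let $(\mathcal H,\langle\cdot,\cdot\rangle)$ be a separable real Hilbert space of dimension $p\in\mathbb N\cup\{+\infty\}$ with norm $\|\cdot\|$, and let $X$ be a centered $\mathcal H$-valued random variable with $\mathbb E\|X\|^2<\infty$. Its covariance operator is $\Sigma=\mathbb E[X\otimes X]$, where $(u\otimes v)x=\langle v,x\rangle u$. Its eigenvalues (with multiplicity) are $\lambda_1\ge\lambda_2\ge\dots>0$, with corresponding eigenvectors assumed to form an orthonormal basis of $\mathcal H$. Let $X_1,\dots,X_n$ be $n\ge1$ independent copies of $X$, and let $\hat\lambda_1\ge\hat\lambda_2\ge\dots\ge0$ be the eigenvalues of $\hat\Sigma=\frac1n\sum_{i=1}^nX_i\otimes X_i$. Here $d$ is a positive integer with $d\le p$; $\|\cdot\|_\infty$ is the operator norm; $a\wedge b=\min(a,b)$.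 $X$ is sub-Gaussian with constant $C_1$ if $\mathbb E\|X\|^2<\infty$ and $\sup_{k\ge1}k^{-1/2}\mathbb E[|\langle X,u\rangle|^k]^{1/k}\le C_1\mathbb E[\langle X,u\rangle^2]^{1/2}$ for all $u\in\mathcal H$. $C_3>1$ is a constant depending only on $C_1$ such that for every centered sub-Gaussian random variable with constant $C_1$ in a separable Hilbert space, with covariance $\Sigma$, largest eigenvalue $\lambda_1$ of $\Sigma$, and sample covariance $\hat\Sigma$ from $n$ independent copies, one has $\mathbb P(\|\Sigma-\hat\Sigma\|_\infty>C_3\lambda_1x)\le e^{-n(x\wedge x^2)}$ whenever $x>0$ and $\operatorname{tr}(\Sigma)\le n\lambda_1(x\wedge x^2)$ (the existence of such $C_3$ is a known theorem of Koltchinskii and Lounici). *)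

(* Defs.v *)
From HB Require Import structures.
From mathcomp Require Import all_boot all_order all_algebra.
From mathcomp Require Import sesquilinear.
From mathcomp Require Import all_classical all_reals all_analysis.

Set Implicit Arguments.
Unset Strict Implicit.
Unset Printing Implicit Defensive.

Import Order.TTheory GRing.Theory Num.Theory.
Import numFieldNormedType.Exports.

Local Open Scope classical_set_scope.
Local Open Scope ring_scope.

(* A real Hilbert space is a complete normed module H together with a positive
   definite symmetric form dot inducing its norm. *)
Definition induces_norm (R : realType) (H : completeNormedModType R)
    (dot : {dot H for idfun}) : Prop :=
  forall x : H, dot x x = `|x| ^+ 2.

Definition separable (T : topologicalType) : Prop :=
  exists2 D : set T, countable D & dense D.

Definition borel_set (T : topologicalType) : set (set T) := <<s (@open T) >>.

(* u (x) v : x |-> <v, x> u *)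
Definition tensor (R : realType) (H : completeNormedModType R)
    (dot : {dot H for idfun}) (u v : H) : H -> H :=
  fun x => dot v x *: u.

(* Indices 1 <= k <= p, where None encodes p = +oo. *)
Definition in_dim (p : option nat) (k : nat) : bool :=
  (0 < k)%N && (if p is Some m then (k <= m)%N else true).

(* (e_k), 1 <= k <= p, is an orthonormal basis of H; in particular dim H = p.
   The values of e outside these indices are irrelevant. *)
Definition orthonormal_basis (R : realType) (H : completeNormedModType R)
    (dot : {dot H for idfun}) (p : option nat) (e : nat -> H) : Prop :=
  (forall j k, in_dim p j -> in_dim p k -> dot (e j) (e k) = (j == k)%:R) /\
  (forall x : H,
    (fun N => \sum_(1 <= k < N.+1 | in_dim p k) dot x (e k) *: e k) @ \oo --> x).

(* mu_1 >= mu_2 >= ... are the eigenvalues of T, with multiplicity, the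
   corresponding eigenvectors forming an orthonormal basis of H. For the
   finite-rank nonnegative operators below such a sequence always exists. *)
Definition ordered_eigenvalues (R : realType) (H : completeNormedModType R)
    (dot : {dot H for idfun}) (p : option nat) (T : H -> H) (mu : nat -> R) :
    Prop :=
  exists e : nat -> H,
    [/\ orthonormal_basis dot p e,
        (forall k, in_dim p k -> T (e k) = mu k *: e k) &
        (forall j k, in_dim p j -> in_dim p k -> (j <= k)%N -> mu k <= mu j)].

Definition eigenvalue_op (R : realType) (H : completeNormedModType R)
    (T : H -> H) (l : R) : Prop :=
  exists2 x : H, x != 0 & T x = l *: x.

Definition largest_eigenvalue (R : realType) (H : completeNormedModType R)
    (T : H -> H) (l : R) : Prop :=
  eigenvalue_op T l /\ forall m : R, eigenvalue_op T m -> m <= l.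

Definition operator_norm (R : realType) (H : completeNormedModType R)
    (T : H -> H) : \bar R :=
  ereal_sup [set (`|T x|)%:E | x in [set x : H | `|x| <= 1]].

(* For nonnegative T this does not depend on the orthonormal basis e. *)
Definition trace (R : realType) (H : completeNormedModType R)
    (dot : {dot H for idfun}) (p : option nat) (e : nat -> H) (T : H -> H) :
    \bar R :=
  (\sum_(1 <= k <oo | in_dim p k) (dot (T (e k)) (e k))%:E)%E.

Section random_elements.
Context (R : realType) (H : completeNormedModType R) (dot : {dot H for idfun}).
Context (dd : measure_display) (Omega : measurableType dd).
Variable P : probability Omega R.

Definition random_element (X : Omega -> H) : Prop :=
  forall A, borel_set A -> measurable (X @^-1` A).

Definition square_integrable (X : Omega -> H) : Prop :=
  ('E_P[fun w => (`|X w| ^+ 2)%R] < +oo)%E.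

(* m = E[Y] in H: Y is integrable and E<Y, u> = <m, u> for all u. *)
Definition is_expectation (Y : Omega -> H) (m : H) : Prop :=
  P.-integrable setT (fun w => (`|Y w|)%:E) /\
  (forall u : H, 'E_P[fun w => dot (Y w) u] = (dot m u)%:E)%E.

Definition centered (X : Omega -> H) : Prop := is_expectation X 0.

(* Sigma = E[X (x) X], the expectation being taken pointwise on H. *)
Definition is_covariance (X : Omega -> H) (Sigma : H -> H) : Prop :=
  forall x : H, is_expectation (fun w => tensor dot (X w) (X w) x) (Sigma x).

Definition sub_gaussian (C1 : R) (X : Omega -> H) : Prop :=
  square_integrable X /\
  forall u : H,
    (ereal_sup [set (k%:R `^ (- 2^-1))%:E *
                    'E_P[fun w => (`|dot (X w) u| ^+ k)%R] `^ k%:R^-1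
               | k in [set k : nat | (1 <= k)%N]]
     <= C1%:E * 'E_P[fun w => (dot (X w) u ^+ 2)%R] `^ 2^-1)%E.

Definition mutually_independent (n : nat) (Xs : 'I_n -> Omega -> H) : Prop :=
  forall A : 'I_n -> set H, (forall i, borel_set (A i)) ->
    P [set w | forall i, A i (Xs i w)] = (\prod_(i < n) P (Xs i @^-1` A i))%E.

Definition independent_copies (X : Omega -> H) (n : nat)
    (Xs : 'I_n -> Omega -> H) : Prop :=
  [/\ forall i, random_element (Xs i),
      forall i A, borel_set A -> P (Xs i @^-1` A) = P (X @^-1` A) &
      mutually_independent Xs].

Definition sample_covariance (n : nat) (Xs : 'I_n -> Omega -> H) (w : Omega) :
    H -> H :=
  fun x => n%:R^-1 *: \sum_(i < n) tensor dot (Xs i w) (Xs i w) x.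

End random_elements.

(* The Koltchinskii-Lounici concentration property of the constant C3: it is
   required of all random variables that are sub-Gaussian with constant C1, in
   all separable Hilbert spaces. *)
Definition covariance_concentration (R : realType) (C1 C3 : R) : Prop :=
  forall (H : completeNormedModType R) (dot : {dot H for idfun})
    (dd : measure_display) (Omega : measurableType dd) (P : probability Omega R)
    (X : Omega -> H) (Sigma : H -> H) (p : option nat) (e : nat -> H)
    (l1 : R) (n : nat) (Xs : 'I_n -> Omega -> H),
  induces_norm dot -> separable H ->
  random_element X -> centered dot P X -> sub_gaussian dot P C1 X ->
  is_covariance dot P X Sigma ->
  orthonormal_basis dot p e ->
  largest_eigenvalue Sigma l1 ->
  (0 < n)%N -> independent_copies P X Xs ->
  forall x : R, 0 < x ->
    (trace dot p e Sigma <= (n%:R * l1 * Num.min x (x ^+ 2))%:E)%E ->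
    (P [set w | (C3 * l1 * x)%:E <
                operator_norm (fun u => Sigma u - sample_covariance dot Xs w u)%R]
     <= (expR (- (n%:R * Num.min x (x ^+ 2))))%:E)%E.

(* Main.v *)
(* Let [mu = (1 + y) lam_d].  By min-max, [lhat_d > mu] produces a nonzero [u] in
   the span of [e_k], [k >= d], with [<(Shat - Sigma) u, u> > <(mu - Sigma) u, u>].
   With [T = (mu - Sigma)^(-1/2)] on this span and [0] on its complement, this says
   that the covariance error of the sample [T X_i] has operator norm above [1].  As
   [T X] is again sub-Gaussian with constant [C1], as its covariance has largest
   eigenvalue [1/y] and trace [sum_(k >= d) lam_k / (mu - lam_k)], the concentration
   property with [x = y / C3] applies once [n min(y, y^2) >= 2 C3^2]; otherwise the
   bound exceeds [1].  The left tail is the same with [mu = (1 - y) lam_d], the span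
   of [e_k], [k <= d], and [T = (Sigma - mu)^(-1/2)]; there [y < 1] may be assumed.

   A measure here is unconstrained on non-measurable sets, so the measurability of
   [lhat_d] and of the operator norm of the error must be proved as well. *)

Require Import Defs.
From HB Require Import structures.
From mathcomp Require Import all_boot all_order all_algebra.
From mathcomp Require Import sesquilinear ring lra.
From mathcomp Require Import all_classical all_reals all_analysis.
From mathcomp Require Import measurable_realfun.

Set Implicit Arguments.
Unset Strict Implicit.
Unset Printing Implicit Defensive.

Import Order.TTheory GRing.Theory Num.Theory.
Import numFieldNormedType.Exports.

Local Open Scope classical_set_scope.
Local Open Scope ring_scope.

(** * Orthonormal bases *)

Section hilbert.
Context {R : realType} {H : completeNormedModType R} (dot : {dot H for idfun}).
Implicit Types x y z : H.

Lemma dotC x y : dot x y = dot y x.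
Proof. by rewrite hermC /= expr0 mul1r. Qed.

Lemma dotDl x y z : dot (x + y) z = dot x z + dot y z.
Proof. by rewrite linearDl. Qed.
Lemma dotZl (a : R) x z : dot (a *: x) z = a * dot x z.
Proof. by rewrite linearZl_LR. Qed.
Lemma dotDr x y z : dot z (x + y) = dot z x + dot z y.
Proof. by rewrite linearDr. Qed.
Lemma dotZr (a : R) x z : dot z (a *: x) = a * dot z x.
Proof. by rewrite dotC dotZl dotC. Qed.
Lemma dotNl x z : dot (- x) z = - dot x z.
Proof. by rewrite linearNl. Qed.
Lemma dotNr x z : dot z (- x) = - dot z x.
Proof. by rewrite linearNr. Qed.
Lemma dotBl x y z : dot (x - y) z = dot x z - dot y z.
Proof. by rewrite dotDl dotNl. Qed.
Lemma dotBr x y z : dot z (x - y) = dot z x - dot z y.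
Proof. by rewrite dotDr dotNr. Qed.
Lemma dot0l z : dot 0 z = 0.
Proof. by rewrite linear0l. Qed.
Lemma dot0r z : dot z 0 = 0.
Proof. by rewrite linear0r. Qed.
Lemma dot_suml (I : Type) (r : seq I) (P : pred I) (F : I -> H) z :
  dot (\sum_(i <- r | P i) F i) z = \sum_(i <- r | P i) dot (F i) z.
Proof. exact: linear_sumlz. Qed.
Lemma dot_sumr (I : Type) (r : seq I) (P : pred I) (F : I -> H) z :
  dot z (\sum_(i <- r | P i) F i) = \sum_(i <- r | P i) dot z (F i).
Proof. by rewrite linear_sumr. Qed.

Hypothesis hn : induces_norm dot.

Lemma cauchy_schwarz x y : `|dot x y| <= `|x| * `|y|.
Proof.
have [->|y0] := eqVneq y 0; first by rewrite dot0r !normr0 mulr0.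
have yy : 0 < dot y y by rewrite hn exprn_gt0 // normr_gt0.
rewrite -(ler_pXn2r (n := 2)) ?nnegrE // ?mulr_ge0 //.
rewrite exprMn -!hn real_normK ?num_real //.
rewrite -subr_ge0.
(* The square of the component of [x] orthogonal to [y], scaled by [dot y y] to avoid a division; it
   factors as [dot y y] times the wanted difference. *)
have : 0 <= dot (dot y y *: x - dot x y *: y) (dot y y *: x - dot x y *: y).
  by rewrite hn sqr_ge0.
rewrite dotBl !dotBr !dotZl !dotZr (dotC y x).
rewrite [X in 0 <= X](_ : _ = dot y y * (dot x x * dot y y - dot x y ^+ 2)); last by ring.
by rewrite pmulr_rge0.
Qed.

Lemma dot_continuous y : continuous (fun x => dot x y).
Proof.
move=> x; apply/cvgrPdist_le => /= e e0.
have Y : 0 < `|y| + 1 by rewrite ltr_pwDr.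
near=> z.
rewrite -dotBl (le_trans (cauchy_schwarz _ _))//.
rewrite (@le_trans _ _ (`|x - z| * (`|y| + 1))) ?ler_wpM2l ?lerDl//.
rewrite -ler_pdivlMr//.
near: z; apply: cvgr_dist_le => //; exact: divr_gt0.
Unshelve. all: by end_near. Qed.

Lemma dot_inj x y : (forall u, dot x u = dot y u) -> x = y.
Proof.
move=> xy; apply/eqP; rewrite -subr_eq0 -normr_eq0 -sqrf_eq0 -hn.
by rewrite dotBl xy subrr.
Qed.

Variables (p : option nat) (e : nat -> H).
Hypothesis he : orthonormal_basis dot p e.

Lemma dot_basis j k : in_dim p j -> in_dim p k -> dot (e j) (e k) = (j == k)%:R.
Proof. exact: he.1. Qed.

Lemma norm_basis k : in_dim p k -> `|e k| = 1.
Proof.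
by move=> kp; apply/eqP; rewrite -(@pexpr_eq1 _ _ 2)// -hn dot_basis// !eqxx.
Qed.

Lemma parseval x y :
  (fun N => \sum_(1 <= k < N.+1 | in_dim p k) dot x (e k) * dot y (e k))
    @ \oo --> dot x y.
Proof.
have := cvg_comp _ _ (he.2 x) (@dot_continuous y x).
apply: cvg_trans; apply: near_eq_cvg; apply: nearW => N /=.
rewrite dot_suml; apply: eq_bigr => k _.
by rewrite dotZl (dotC (e k)).
Qed.

Arguments parseval x y : clear implicits.

Lemma dot_basis_inj x y : (forall k, in_dim p k -> dot x (e k) = dot y (e k)) -> x = y.
Proof.
move=> xy; apply: dot_inj => u.
rewrite -(cvg_lim _ (parseval x u))// -(cvg_lim _ (parseval y u))//.
congr (lim (_ @ \oo)); apply/funext => N /=.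
by apply: eq_bigr => k /xy ->.
Qed.

(** Parseval sums compare term by term, and the order survives the limit. All norm and quadratic
    form bounds for diagonal operators reduce to this. *)
Lemma le_parseval x y x' y' :
  (forall k, in_dim p k ->
    dot x (e k) * dot y (e k) <= dot x' (e k) * dot y' (e k)) ->
  dot x y <= dot x' y'.
Proof.
move=> le; apply: ler_cvg_to (parseval x y) (parseval x' y') _.
by apply: nearW => N; apply: ler_sum => k; exact: le.
Qed.

End hilbert.

Arguments parseval {R H dot} hn {p e} he x y.

(** * Diagonal and self-adjoint operators *)

(** Stated on the coordinates of [T x] for every [x], so that it determines [T] on all of [H]
    without presupposing linearity or continuity. *)
Definition diagonal {R : realType} {H : completeNormedModType R}
    (dot : {dot H for idfun}) (p : option nat) (e : nat -> H)
    (t : nat -> R) (T : H -> H) :=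
  forall x k, in_dim p k -> dot (T x) (e k) = t k * dot x (e k).

Definition self_adjoint {R : realType} {H : completeNormedModType R}
    (dot : {dot H for idfun}) (T : H -> H) :=
  forall x y, dot (T x) y = dot x (T y).

Section operators.
Context {R : realType} {H : completeNormedModType R} (dot : {dot H for idfun}).
Implicit Types (x y : H) (S T : H -> H).
Hypothesis hn : induces_norm dot.

Section self_adjoint.
Variables (T : H -> H).
Hypothesis Tsym : self_adjoint dot T.

(** Linearity is a consequence of symmetry: [T] is moved to the other argument of [dot], which is
    already linear, and vectors are separated by their inner products. *)
Lemma self_adjointZ a x : T (a *: x) = a *: T x.
Proof. by apply: (dot_inj hn) => u; rewrite Tsym !dotZl -!Tsym. Qed.

Lemma self_adjointB x y : T (x - y) = T x - T y.
Proof. by apply: (dot_inj hn) => u; rewrite Tsym !dotBl -!Tsym. Qed.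

Lemma bounded_continuous b : (forall x, `|T x| <= b * `|x|) -> continuous T.
Proof.
move=> Tb x; apply/cvgrPdist_le => /= r r0.
have B : 0 < `|b| + 1 by rewrite ltr_pwDr.
near=> z.
rewrite -self_adjointB (le_trans (Tb _))//.
rewrite (@le_trans _ _ ((`|b| + 1) * `|x - z|)) ?ler_wpM2r//.
  by rewrite (le_trans (ler_norm b))// lerDl.
rewrite mulrC -ler_pdivlMr//.
near: z; apply: cvgr_dist_le => //; exact: divr_gt0.
Unshelve. all: by end_near. Qed.

(** Cauchy-Schwarz turns the large quadratic form into [c * |v| < |T v|], and the normalized [v] is
    then a witness in the unit ball. *)
Lemma operator_norm_gt c v : 0 <= c -> c * `|v| ^+ 2 < `|dot (T v) v| ->
  (c%:E < operator_norm T)%E.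
Proof.
move=> c0 cv.
have v0 : 0 < `|v|.
  rewrite normr_gt0; apply: contraTneq cv => ->.
  by rewrite dot0r !normr0 expr0n/= mulr0 ltxx.
have := lt_le_trans cv (cauchy_schwarz hn _ _).
rewrite expr2 mulrA ltr_pM2r// => cTv.
apply: (@lt_le_trans _ _ (`|T (`|v|^-1 *: v)|)%:E); last first.
  apply: ereal_sup_ubound; exists (`|v|^-1 *: v) => //=.
  by rewrite normrZ normfV normr_id mulVf// gt_eqF.
by rewrite lte_fin self_adjointZ normrZ normfV normr_id mulrC ltr_pdivlMr.
Qed.

End self_adjoint.

Variables (p : option nat) (e : nat -> H).
Hypothesis he : orthonormal_basis dot p e.

Lemma dot_sum_basis m n (c : nat -> R) k : in_dim p k ->
  dot (\sum_(m <= j < n | in_dim p j) c j *: e j) (e k) =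
  if (m <= k < n)%N then c k else 0.
Proof.
move=> kp; rewrite dot_suml big_seq_cond.
rewrite (eq_bigr (fun j => if j == k then c k else 0)); last first.
  move=> j /andP[_ jp]; rewrite dotZl (dot_basis he)//.
  by case: eqP => [->|]; rewrite ?mulr1 ?mulr0.
rewrite -big_mkcondr/=; case: ifP => kmn.
  rewrite -big_filter (_ : [seq j <- _ | _] = [:: k]) ?big_seq1//.
  rewrite -(filter_pred1_uniq (s := index_iota m n)) ?iota_uniq ?mem_index_iota//.
  apply: eq_in_filter => j jmn; rewrite mem_index_iota in jmn.
  rewrite mem_index_iota jmn /=.
  by case: eqP => [->|]; rewrite ?kp ?andbF.
rewrite big1// => j /andP[/andP[jmn _] /eqP jk].
by move: jmn; rewrite jk mem_index_iota kmn.
Qed.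

Lemma norm_sum_basis m n (c : nat -> R) :
  `|\sum_(m <= j < n | in_dim p j) c j *: e j| ^+ 2 =
  \sum_(m <= j < n | in_dim p j) c j ^+ 2.
Proof.
rewrite -hn {2}big_seq_cond dot_sumr [RHS]big_seq_cond.
apply: eq_bigr => k /andP[]; rewrite mem_index_iota => kmn kp.
by rewrite dotZr dot_sum_basis// kmn.
Qed.

(** [T x] is the sum of the series of [t k * dot x (e k) *: e k], which converges by
    completeness. *)
Lemma diagonal_exists (t : nat -> R) b :
  (forall k, in_dim p k -> `|t k| <= b) ->
  exists T, diagonal dot p e t T.
Proof.
move=> tb.
suff Tx x : exists y, forall k, in_dim p k -> dot y (e k) = t k * dot x (e k).
  exists (fun x => projT1 (cid (Tx x))) => x.
  exact: (projT2 (cid (Tx x))).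
(* Zero padding turns sums over [in_dim p] into plain series; index 0 is padded too, so the partial
   sum up to [N.+1] starts effectively at 1. *)
pose u (c : nat -> R) k := if in_dim p k then c k *: e k else 0.
have uE c m n : \sum_(m <= k < n) u c k = \sum_(m <= k < n | in_dim p k) c k *: e k.
  by rewrite [RHS]big_mkcond.
have sE c N : series (u c) N.+1 = \sum_(1 <= k < N.+1 | in_dim p k) c k *: e k.
  by rewrite /series/= big_ltn// {1}/u/= add0r uE.
set cx := fun k => dot x (e k).
have cvgx : cvgn (series (u cx)).
  apply/cvg_ex; exists x; rewrite /= -cvg_shiftS/=.
  by under eq_fun do rewrite sE; exact: he.2.
pose ct k := t k * cx k.
have cvgt : cvgn (series (u ct)).
  (* By orthogonality, a block of the weighted series has norm at most [|b| + 1] times that of the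
     same block in the expansion of [x]. The added 1 keeps the divisor positive. *)
  apply/cauchy_cvgP/cauchy_seriesP => r r0.
  have B : 0 < `|b| + 1 by rewrite ltr_pwDr.
  move/cauchy_cvgP/cauchy_seriesP : cvgx => /(_ (r / (`|b| + 1)) (divr_gt0 r0 B)).
  apply: filterS => n; rewrite ltr_pdivlMr// => h; apply: le_lt_trans h.
  rewrite !uE -(ler_pXn2r (n := 2)) ?nnegrE ?mulr_ge0// ?(ltW B)//.
  rewrite exprMn !norm_sum_basis mulr_suml; apply: ler_sum => k kp.
  rewrite exprMn mulrC ler_wpM2l ?sqr_ge0//.
  rewrite -real_normK ?num_real// ler_pXn2r ?nnegrE ?(ltW B)//.
  by rewrite (le_trans (tb _ kp))// (le_trans (ler_norm b))// lerDl.
exists (limn (series (u ct))) => k kp.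
have := cvg_comp _ _ cvgt (@dot_continuous _ _ _ hn (e k) (limn (series (u ct)))).
move/(cvg_lim (@Rhausdorff R)) => <-.
apply: lim_near_cst => //.
near=> N => /=.
rewrite /series/= uE dot_sum_basis//.
by rewrite ifT//; near: N; exact: nbhs_infty_gt.
Unshelve. all: by end_near. Qed.

Section diagonal.
Variables (T : H -> H) (t : nat -> R).
Hypothesis Td : diagonal dot p e t T.

Lemma diagonal_self_adjoint : self_adjoint dot T.
Proof.
move=> x y.
rewrite -(cvg_lim _ (parseval hn he (T x) y))// -(cvg_lim _ (parseval hn he x (T y)))//.
congr (lim (_ @ \oo)); apply/funext => N /=.
by apply: eq_bigr => k kp; rewrite !Td//; ring.
Qed.

Lemma diagonal_bounded b : (forall k, in_dim p k -> `|t k| <= b) -> 0 <= b ->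
  forall x, `|T x| <= b * `|x|.
Proof.
move=> tb b0 x; rewrite -(ler_pXn2r (n := 2)) ?nnegrE ?mulr_ge0//.
rewrite exprMn -!hn [leRHS](_ : _ = dot (b *: x) (b *: x)); last first.
  by rewrite dotZl dotZr; ring.
apply: (le_parseval hn he) => k kp.
rewrite !Td// !dotZl -!expr2 !exprMn ler_wpM2r ?sqr_ge0//.
by rewrite -real_normK ?num_real// ler_pXn2r ?nnegrE ?tb.
Qed.

(** Subspaces enter only through vanishing coordinates: the spectral bound is asked for just at the
    indices that [u] may see. *)
Lemma quad_ge c u :
  (forall k, in_dim p k -> dot u (e k) = 0 \/ c <= t k) ->
  c * `|u| ^+ 2 <= dot (T u) u.
Proof.
move=> cu; rewrite -hn -dotZl; apply: (le_parseval hn he) => k kp.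
rewrite Td// dotZl -!mulrA; case: (cu k kp) => [->|ct]; first by rewrite !mulr0.
by rewrite ler_wpM2r// -expr2 sqr_ge0.
Qed.

Lemma quad_le c u :
  (forall k, in_dim p k -> dot u (e k) = 0 \/ t k <= c) ->
  dot (T u) u <= c * `|u| ^+ 2.
Proof.
move=> cu; rewrite -hn -dotZl; apply: (le_parseval hn he) => k kp.
rewrite Td// dotZl -!mulrA; case: (cu k kp) => [->|ct]; first by rewrite !mulr0.
by rewrite ler_wpM2r// -expr2 sqr_ge0.
Qed.

End diagonal.

Lemma self_adjoint_diagonal T t : self_adjoint dot T ->
  (forall k, in_dim p k -> T (e k) = t k *: e k) -> diagonal dot p e t T.
Proof. by move=> Ts Te x k kp; rewrite Ts Te// dotZr. Qed.

(** Dimension count: orthogonality to [m] vectors imposes [m] linear conditions on [m.+1]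
    coefficients, so the matrix of inner products has a nonzero left kernel. *)
Lemma exists_span_ortho m (h : nat -> H) : in_dim p m.+1 ->
  exists2 u, u != 0 &
    (forall k, in_dim p k -> (m.+1 < k)%N -> dot u (e k) = 0) /\
    (forall j, (0 < j <= m)%N -> dot u (h j) = 0).
Proof.
move=> mp.
pose M : 'M[R]_(m.+1, m) := \matrix_(i, j) dot (e i.+1) (h j.+1).
have : kermx M != 0.
  by rewrite kermx_eq0 /row_free ltn_eqF// ltnS rank_leq_col.
case/rowV0Pn => a /sub_kermxP aM a0.
(* Basis vectors are numbered from 1, matrix rows from 0. *)
pose c k := a ord0 (inord k.-1).
pose u := \sum_(1 <= k < m.+2 | in_dim p k) c k *: e k.
have dimk k : (0 < k <= m.+1)%N -> in_dim p k.
  move=> /andP[k0 km]; move: mp; rewrite /in_dim k0 /=.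
  by case: (p) => // q; apply: leq_trans.
have uk k : in_dim p k -> dot u (e k) = if (1 <= k < m.+2)%N then c k else 0.
  exact: dot_sum_basis.
exists u; last split.
- apply: contra a0 => /eqP u0; apply/eqP/rowP => i.
  have ip : in_dim p i.+1 by apply: dimk; rewrite /= ltn_ord.
  move: (uk _ ip); rewrite u0 dot0l /= ltnS ltn_ord /c /= inord_val => <-.
  by rewrite mxE.
- by move=> k kp km; rewrite uk// ifF// [(k < _)%N]ltnNge km andbF.
- case=> // j /andP[_ jm]; have := congr1 (fun A : 'rV_m => A ord0 (Ordinal jm)) aM.
  rewrite !mxE => <-; rewrite /u dot_suml.
  rewrite big_add1 /= big_mkcond/= big_mkord; apply: eq_bigr => i _.
  rewrite dimk ?ltn_ord// dotZl /M mxE /= /c /=.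
  by congr (a _ _ * _); apply: val_inj; rewrite /= inordK.
Qed.

End operators.

(** * Measurability of operator norms and eigenvalues *)

Section density.
Context {R : realType} {T : topologicalType}.

Lemma separable_seq (t0 : T) : separable T ->
  exists q : nat -> T, forall O, O !=set0 -> open O -> exists n, O (q n).
Proof.
case=> D /countable_injP[f finj] dD.
(* [t0] fills the positions that are not the code of a point of [D]. *)
exists (fun n => if pselect (exists2 x, D x & f x = n) is left h
                 then projT1 (cid2 h) else t0) => O O0 oO.
have [x [Ox Dx]] := dD _ O0 oO.
exists (f x); case: pselect => [h|[]]; last by exists x.
by case: cid2 => /= y Dy fyx; rewrite (finj y x) ?inE.
Qed.

Lemma dense_ge0 (q : nat -> T) (F : T -> R) :
  (forall O, O !=set0 -> open O -> exists n, O (q n)) ->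
  continuous F -> (forall n, 0 <= F (q n)) -> forall x, 0 <= F x.
Proof.
move=> dq cF F0 x; rewrite leNgt; apply/negP => Fx.
have [n] : exists n, (F @^-1` [set r | r < 0]) (q n).
  by apply: dq; [exists x | apply: open_comp => //; exact: open_lt].
by rewrite /= ltNge F0.
Qed.

End density.

Section measurability.
Context {R : realType} {H : completeNormedModType R} (dot : {dot H for idfun}).
Hypothesis hn : induces_norm dot.

Lemma cvg_dot (I : Type) (F : set_system I) {FF : Filter F} (f g : I -> H) a b :
  f @ F --> a -> g @ F --> b -> dot (f x) (g x) @[x --> F] --> dot a b.
Proof.
move=> fa gb.
(* Polarization reduces joint continuity of [dot] to continuity of the norm. *)
have polar x y : dot x y = 2^-1 * (`|x + y| * `|x + y| - `|x| * `|x| - `|y| * `|y|).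
  by rewrite -!expr2 -!hn dotDl !dotDr (dotC dot y x); field.
rewrite polar; under eq_fun do rewrite polar.
apply: cvgM; first exact: cvg_cst.
by apply: cvgB; [apply: cvgB|]; apply: cvgM; apply: cvg_norm => //; apply: cvgD.
Qed.

Lemma borel_set_preimage (T : H -> H) : continuous T ->
  forall A, borel_set A -> borel_set (T @^-1` A).
Proof.
move=> cT.
suff : borel_set (T := H) `<=` [set A | borel_set (T @^-1` A)] by exact.
apply: smallest_sub => //=; first split => /=.
- exact: sigma_algebra0.
- by move=> B mB; exact: (sigma_algebraCD mB).
- by move=> B mB; exact: (sigma_algebra_bigcup mB).
by move=> O oO; apply: sub_sigma_algebra; apply: open_comp.
Qed.

Context (dd : measure_display) (Omega : measurableType dd).

Definition weakly_measurable (Z : Omega -> H) :=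
  forall u, measurable_fun setT (fun w => dot (Z w) u).

Lemma random_element_weakly (X : Omega -> H) :
  random_element X -> weakly_measurable X.
Proof.
move=> mX u; apply: (measurability _ (RGenOpens.measurableE R)).
move=> _ [_ [a [b ->] <-]]; rewrite setTI.
apply: (mX ((fun x => dot x u) @^-1` `]a, b[)).
apply: sub_sigma_algebra.
apply: open_comp; last exact: interval_open.
by move=> x _; exact: dot_continuous.
Qed.

Lemma random_element_comp (X : Omega -> H) (T : H -> H) : continuous T ->
  random_element X -> random_element (T \o X).
Proof.
by move=> cT mX A mA; rewrite comp_preimage; apply: mX; exact: borel_set_preimage.
Qed.

Section basis.
Variables (p : option nat) (e : nat -> H).
Hypothesis he : orthonormal_basis dot p e.

(** Parseval presents the inner product as a pointwise limit of finite sums of products of real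
    measurable functions. *)
Lemma measurable_dot (Y Z : Omega -> H) :
  weakly_measurable Y -> weakly_measurable Z ->
  measurable_fun setT (fun w => dot (Y w) (Z w)).
Proof.
move=> mY mZ.
apply: (@measurable_fun_cvg _ _ _ _ (fun N w =>
  \sum_(1 <= k < N.+1 | in_dim p k) dot (Y w) (e k) * dot (Z w) (e k))).
  move=> N; under eq_fun do rewrite big_mkcond/=.
  apply: measurable_sum => k; case: (in_dim p k) => //.
  exact: measurable_funM.
by move=> w _; exact: parseval.
Qed.

Lemma measurable_norm (Z : Omega -> H) :
  weakly_measurable Z -> measurable_fun setT (fun w => `|Z w|).
Proof.
move=> mZ.
rewrite (_ : (fun _ => _) = (@Num.sqrt R) \o (fun w => dot (Z w) (Z w))).
  apply: measurableT_comp; last exact: measurable_dot.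
  by apply: continuous_measurable_fun; exact: sqrt_continuous.
by apply/funext => w /=; rewrite hn sqrtr_sqr normr_id.
Qed.

End basis.

Lemma measurable_ler (f g : Omega -> R) : measurable_fun setT f ->
  measurable_fun setT g -> measurable [set w | f w <= g w].
Proof.
move=> mf mg; have := measurable_fun_ler mf mg measurableT (Y := [set true]).
by rewrite setTI preimage_true; exact.
Qed.

Lemma measurable_ltr (f g : Omega -> R) : measurable_fun setT f ->
  measurable_fun setT g -> measurable [set w | f w < g w].
Proof.
move=> mf mg; have := measurable_fun_ltr mf mg measurableT (Y := [set true]).
by rewrite setTI preimage_true; exact.
Qed.

Hypothesis sepH : separable H.

(** By continuity, the supremum over the unit ball may be tested on a dense sequence, which leaves a
    countable union of measurable events. *)
Lemma measurable_operator_norm_gt p (e : nat -> H) (A : Omega -> H -> H) c :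
  orthonormal_basis dot p e ->
  (forall w, self_adjoint dot (A w)) ->
  (forall w, exists b, forall x, `|A w x| <= b * `|x|) ->
  (forall u, weakly_measurable (A ^~ u)) ->
  measurable [set w | (c%:E < operator_norm (A w))%E].
Proof.
move=> he As Ab Am; have [q dq] := separable_seq 0 sepH.
have cA w : continuous (A w).
  by have [b hb] := Ab w; exact: (bounded_continuous hn (As w) hb).
rewrite (_ : [set _ | _] =
  \bigcup_(n in [set n | `|q n| <= 1]) [set w | c < `|A w (q n)|]); last first.
  apply/seteqP; split => w /=.
    move=> /ereal_sup_gt[_ [u /= u1 <-]]; rewrite lte_fin => cu.
    have cNA : continuous (fun x => `|A w x|).
      by move=> x; apply: cvg_norm; exact: cA.
    have [n [/= n1 cn]] : exists n,
        ((fun x => `|x|) @^-1` [set r : R | r < 1] `&`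
         (fun x => `|A w x|) @^-1` [set r | c < r]) (q n).
      apply: dq; last first.
        apply: openI; apply: open_comp => //.
        by move=> x _; exact: norm_continuous.
      (* Density only yields points of open sets, and the ball is closed: shrinking [u] slightly
         moves it into the open ball while the value stays above [c]. *)
      have : `|A w (k *: u)| @[k --> (1 : R)^'-] --> `|A w (1 *: u)|.
        apply: cvg_at_left_filter.
        apply: (@continuous_comp _ _ _ (fun k : R => k *: u) (fun x => `|A w x|)).
          by apply: cvgZr_tmp; exact: cvg_id.
        exact: cNA.
      rewrite scale1r => /cvgr_gt/(_ _ cu) hc.
      near (1 : R)^'- => k.
      exists (k *: u) => /=; split; last by near: k.
      rewrite normrZ (@le_lt_trans _ _ `|k|) ?ler_piMr//.
      by rewrite ger0_norm; near: k; [exact: nbhs_left_lt|exact: nbhs_left_ge].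
    by exists n => //=; exact: ltW.
  move=> [n /= n1 cn]; apply: (lt_le_trans (y := (`|A w (q n)|)%:E)).
    by rewrite lte_fin.
  by apply: ereal_sup_ubound; exists (q n).
apply: bigcup_measurable => n _; apply: measurable_ltr => //.
exact: (measurable_norm he).
Unshelve. all: by end_near. Qed.

(* Courant-Fischer with the rank-one forms [sqrt (mu j) e_j], [j < d], approximated
   within a dense sequence, so that only countable quantifiers occur. *)
Lemma eigenvalue_leP p (e : nat -> H) (B : H -> H) mu (q : nat -> H) d a :
  (forall O, O !=set0 -> open O -> exists n, O (q n)) ->
  orthonormal_basis dot p e -> diagonal dot p e mu B ->
  (forall j k, in_dim p j -> in_dim p k -> (j <= k)%N -> mu k <= mu j) ->
  (forall k, in_dim p k -> 0 <= mu k) -> in_dim p d ->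
  mu d <= a <->
  forall k, exists s : seq nat, forall n,
    dot (B (q n)) (q n) <= (a + k.+1%:R^-1) * dot (q n) (q n)
      + \sum_(1 <= j < d) dot (q n) (q (nth 0%N s j)) ^+ 2.
Proof.
move=> dq he Bd mono mu0 dp.
have d0 : (0 < d)%N by case/andP: dp.
have dimk k : (0 < k <= d)%N -> in_dim p k.
  move=> /andP[k0 km]; move: dp; rewrite /in_dim k0 d0 /=.
  by case: (p) => // r; apply: leq_trans.
split=> [mua k|h].
  pose z j := Num.sqrt (mu j) *: e j.
  (* The slack [k.+1%:R^-1] is cut into [d] equal shares; each index [0 < j < d] spends one on
     replacing [z j] by a point of the sequence. *)
  pose eta : R := k.+1%:R^-1 / d%:R.
  have eta0 : 0 < eta by rewrite divr_gt0 ?ltr0n// invr_gt0 ltr0n.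
  have /choice[g hg] : forall j, exists n, `|z j - q n| * (`|z j| + `|q n|) < eta.
    move=> j.
    have := dq ((fun x => `|z j - x| * (`|z j| + `|x|)) @^-1` [set r | r < eta]).
    apply; first by exists (z j); rewrite /= subrr normr0 mul0r.
    apply: open_comp; last exact: open_lt.
    move=> x _; apply: cvgM; first apply: cvg_norm; apply: cvgD => //.
    - exact: cvg_cst.
    - exact: cvgN.
    - exact: cvg_cst.
    - exact: norm_continuous.
  exists (mkseq g d) => n; set u := q n.
  (* [B] with its first [d - 1] eigenvalues replaced by 0, so that its form is bounded by [mu d],
     hence by [a]. *)
  pose B' x := B x - \sum_(1 <= j < d | in_dim p j) (mu j * dot x (e j)) *: e j.
  have B'd : diagonal dot p e (fun i => if (i < d)%N then 0 else mu i) B'.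
    move=> x i ip; rewrite dotBl Bd// (dot_sum_basis he)//.
    have -> : (1 <= i)%N by case/andP: ip.
    by rewrite /=; case: ifP => _; rewrite ?subrr ?mul0r ?subr0.
  have : dot (B' u) u <= a * `|u| ^+ 2.
    apply: (quad_le hn he B'd) => i ip; right; case: ltnP => di.
      by rewrite (le_trans _ mua)// mu0.
    by rewrite (le_trans _ mua)// mono.
  rewrite -hn dotBl lerBlDr => /le_trans; apply.
  rewrite mulrDl -addrA lerD2l dot_suml big_nat_cond [in leRHS]big_nat.
  have -> : k.+1%:R^-1 * dot u u = \sum_(0 <= j < d) eta * dot u u.
    rewrite sumr_const_nat subn0 -mulr_natl /eta; field.
    by rewrite pnatr_eq0 -lt0n d0 addrC natr1 pnatr_eq0.
  rewrite [in leRHS](@big_ltn _ _ _ 0)// -addrA.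
  rewrite -[leLHS]add0r; apply: lerD.
    by rewrite mulr_ge0 ?(ltW eta0)// hn sqr_ge0.
  rewrite -[in leRHS]big_nat -big_split/= -big_nat_cond big_mkcond/=.
  rewrite big_nat [in leRHS]big_nat; apply: ler_sum => j /andP[j0 jd].
  rewrite dimk ?j0 ?(ltnW jd)// nth_mkseq// dotZl (dotC _ (e j)).
  have -> : mu j * dot u (e j) * dot u (e j) = dot u (z j) ^+ 2.
    by rewrite dotZr exprMn sqr_sqrtr ?mu0 ?dimk ?j0 ?(ltnW jd)//; ring.
  (* The difference of squares factors as [dot u (z - q) * dot u (z + q)], which the choice of [g j]
     bounds by [eta * |u|^2]. *)
  rewrite -lerBlDr subr_sqr -dotBr -dotDr hn.
  apply: (le_trans (ler_norm _)); rewrite normrM.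
  apply: (@le_trans _ _ ((`|u| * `|z j - q (g j)|) * (`|u| * (`|z j| + `|q (g j)|)))).
    apply: ler_pM => //; first exact: cauchy_schwarz.
    rewrite (le_trans (cauchy_schwarz hn _ _))// ler_wpM2l//.
    exact: ler_normD.
  rewrite mulrACA -expr2 mulrC ler_wpM2r ?sqr_ge0// ltW//.
apply/ler_addgt0Pr => r r0.
near \oo => k.
have kr : (k.+1%:R^-1 : R) < r by near: k; exact: near_infty_natSinv_lt (PosNum r0).
rewrite (@le_trans _ _ (a + k.+1%:R^-1))//; last by rewrite lerD2l ltW.
have [s hs] := h k.
have Bs := diagonal_self_adjoint hn he Bd.
have Bb : forall x, `|B x| <= mu 1%N * `|x|.
  apply: (diagonal_bounded hn he Bd).
    move=> i ip; rewrite ger0_norm ?mu0//; apply: mono => //; first exact: dimk.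
    by case/andP: ip.
  by rewrite mu0 ?dimk.
(* Both sides are continuous, so the inequality passes from the dense sequence to all vectors. *)
have {}hs u : dot (B u) u <= (a + k.+1%:R^-1) * dot u u
      + \sum_(1 <= j < d) dot u (q (nth 0%N s j)) ^+ 2.
  rewrite -subr_ge0; apply: (dense_ge0 (q := q) (F := fun u =>
    (a + k.+1%:R^-1) * dot u u + \sum_(1 <= j < d) dot u (q (nth 0%N s j)) ^+ 2
     - dot (B u) u)) => //; last by move=> n; rewrite subr_ge0.
  move=> x; apply: cvgB; last first.
    by apply: cvg_dot => //; exact: (bounded_continuous hn Bs Bb).
  apply: cvgD; first by apply: cvgM; [exact: cvg_cst|apply: cvg_dot].
  by apply: cvg_big => [|j _]; [exact: add_continuous|apply: cvgM]; exact: dot_continuous.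
case: d dp dimk hs d0 {h} => // m mp dimk hs _.
(* On a vector of the span of the first [d] eigenvectors orthogonal to the [d - 1] chosen points,
   the penalty vanishes and the form is at least [mu d * |u|^2]. *)
have [u u0 [ue uq]] := exists_span_ortho he (fun j => q (nth 0%N s j)) mp.
have uu : 0 < dot u u by rewrite hn exprn_gt0// normr_gt0.
rewrite -(ler_pM2r uu); apply: (@le_trans _ _ (dot (B u) u)).
  rewrite [in leLHS]hn; apply: (quad_ge hn he Bd) => i ip.
  by case: (leqP i m.+1) => im; [right; exact: mono|left; exact: ue].
rewrite (le_trans (hs u))// -[leRHS]addr0 lerD2l big_nat big1// => j jm.
by rewrite uq// expr0n.
Unshelve. all: by end_near. Qed.

(** The eigenbasis may depend on [w] in a non-measurable way, but the criterion [eigenvalue_leP]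
    does not mention it. Finite sequences of naturals being countable, the sublevel sets are
    countable combinations of measurable events. *)
Lemma measurable_eigenvalue p (B : Omega -> H -> H) (lhat : nat -> Omega -> R) d :
  (forall w, self_adjoint dot (B w)) ->
  (forall u, weakly_measurable (B ^~ u)) ->
  (forall w, ordered_eigenvalues dot p (B w) (lhat ^~ w)) ->
  (forall w k, in_dim p k -> 0 <= lhat k w) -> in_dim p d ->
  measurable_fun setT (lhat d).
Proof.
move=> Bs Bm Bl l0 dp; have [q dq] := separable_seq 0 sepH.
apply: (measurability _ (RGenOInfty.measurableE R)).
move=> _ [_ [a ->] <-]; rewrite setTI.
rewrite -[_ @^-1` _]setCK; apply: measurableC.
rewrite (_ : ~` _ = \bigcap_k \bigcup_(s : seq nat) \bigcap_n
    [set w | dot (B w (q n)) (q n) <= (a + k.+1%:R^-1) * dot (q n) (q n)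
      + \sum_(1 <= j < d) dot (q n) (q (nth 0%N s j)) ^+ 2]); last first.
  apply/seteqP; split => w /=; rewrite in_itv/= andbT;
    case: (Bl w) => e [he Be mono];
    have Bd := self_adjoint_diagonal (Bs w) Be;
    have H2 := @eigenvalue_leP p e (B w) (lhat ^~ w) q d a dq he Bd mono (l0 w) dp.
  - move=> /negP; rewrite -leNgt => /H2 h k _; have [s hs] := h k.
    by exists s => // n _; exact: hs.
  - move=> h; apply/negP; rewrite -leNgt; apply/H2 => k.
    by have [s _ hs] := h k I; exists s => n; exact: hs.
apply: bigcapT_measurable => k; apply: countable_bigcupT_measurable => [|s].
  exact: countableP.
apply: bigcapT_measurable => n; apply: measurable_ler => //.
exact: Bm.
Qed.

End measurability.

(** * Images under a bounded self-adjoint operator *)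

Section images.
Context {R : realType} {H : completeNormedModType R} (dot : {dot H for idfun}).
Context (dd : measure_display) (Omega : measurableType dd).
Hypothesis hn : induces_norm dot.

Section sample_covariance.
Variables (n : nat) (Xs : 'I_n -> Omega -> H).

Lemma dot_sample_covariance w x u :
  dot (sample_covariance dot Xs w x) u =
  n%:R^-1 * \sum_(i < n) dot (Xs i w) x * dot (Xs i w) u.
Proof.
rewrite /sample_covariance dotZl dot_suml; congr (_ * _).
by apply: eq_bigr => i _; rewrite /tensor dotZl.
Qed.

Lemma sample_covariance_self_adjoint w :
  self_adjoint dot (sample_covariance dot Xs w).
Proof.
move=> x u; rewrite (dotC dot x) !dot_sample_covariance; congr (_ * _).
by apply: eq_bigr => i _; rewrite mulrC.
Qed.

Lemma sample_covariance_bounded w x :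
  `|sample_covariance dot Xs w x| <=
  (n%:R^-1 * \sum_(i < n) `|Xs i w| ^+ 2) * `|x|.
Proof.
rewrite normrZ ger0_norm ?invr_ge0// -mulrA ler_wpM2l ?invr_ge0//.
apply: (le_trans (ler_norm_sum _ _ _)); rewrite mulr_suml; apply: ler_sum => i _.
rewrite /tensor normrZ expr2 mulrAC ler_wpM2r//.
exact: cauchy_schwarz.
Qed.

Lemma sample_covariance_weakly x : (forall i, weakly_measurable dot (Xs i)) ->
  weakly_measurable dot (fun w => sample_covariance dot Xs w x).
Proof.
move=> mX u; under eq_fun do rewrite dot_sample_covariance.
apply: measurable_funM => //; apply: measurable_sum => i.
by apply: measurable_funM; exact: mX.
Qed.

End sample_covariance.

Lemma sample_covariance_comp n (Xs : 'I_n -> Omega -> H) (T : H -> H) w x :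
  self_adjoint dot T ->
  sample_covariance dot (fun i => T \o Xs i) w x =
  T (sample_covariance dot Xs w (T x)).
Proof.
move=> Ts; apply: (dot_inj hn) => u; rewrite Ts !dot_sample_covariance.
by congr (_ * _); apply: eq_bigr => i _ /=; rewrite !Ts.
Qed.

Variable P : probability Omega R.

Lemma covariance_self_adjoint X Sigma :
  is_covariance dot P X Sigma -> self_adjoint dot Sigma.
Proof.
move=> cov x y; apply: EFin_inj.
rewrite (dotC dot x) -(proj2 (cov x)) -(proj2 (cov y)); congr ('E_P[_])%E.
by apply/funext => w; rewrite /tensor !dotZl mulrC.
Qed.

Variables (p : option nat) (e : nat -> H).
Hypothesis he : orthonormal_basis dot p e.
Variables (T : H -> H) (b : R).
Hypothesis Ts : self_adjoint dot T.
Hypothesis Tb : forall x, `|T x| <= b * `|x|.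

Lemma weakly_measurable_comp (Y : Omega -> H) : weakly_measurable dot Y ->
  weakly_measurable dot (T \o Y).
Proof. by move=> mY u; under eq_fun do rewrite /= Ts; exact: mY. Qed.

(** [T] passes to the test vector by symmetry, and integrability is inherited through the bound
    [b]. *)
Lemma expectation_comp (Y : Omega -> H) m : weakly_measurable dot Y ->
  is_expectation dot P Y m -> is_expectation dot P (T \o Y) (T m).
Proof.
move=> mY [iY EY]; split; last first.
  by move=> u; under eq_fun do rewrite /= Ts; rewrite EY Ts.
apply: (le_integrable measurableT _ _ (integrableZl measurableT b iY)).
  apply/measurable_EFinP; apply: (measurable_norm hn he).
  exact: weakly_measurable_comp.
move=> w _ /=; rewrite lee_fin normr_id.
by rewrite (le_trans (Tb _))// ler_norm.
Qed.

(** The projection of [T X] on [u] is that of [X] on [T u], and the moment condition ranges over all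
    directions; hence [C1] is unchanged. *)
Lemma sub_gaussian_comp C1 (X : Omega -> H) : weakly_measurable dot X ->
  sub_gaussian dot P C1 X -> sub_gaussian dot P C1 (T \o X).
Proof.
move=> mX [X2 sg]; split; last first.
  move=> u; pose Q (f : Omega -> R) :=
    (ereal_sup [set (k%:R `^ (- 2^-1))%:E *
                    'E_P[fun w => (`|f w| ^+ k)%R] `^ k%:R^-1
               | k in [set k : nat | (1 <= k)%N]]
     <= C1%:E * 'E_P[fun w => (f w ^+ 2)%R] `^ 2^-1)%E.
  change (Q (fun w => dot ((T \o X) w) u)).
  have -> : (fun w => dot ((T \o X) w) u) = (fun w => dot (X w) (T u)).
    by apply/funext => w; exact: Ts.
  exact: sg.
have mN (Z : Omega -> H) : weakly_measurable dot Z ->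
    measurable_fun setT (fun w => `|Z w| ^+ 2).
  by move=> mZ; apply: measurable_funX; exact: (measurable_norm hn he).
apply: (@le_lt_trans _ _ ('E_P[fun w => (b ^+ 2 * `|X w| ^+ 2)%R])%E).
  apply: expectation_le.
  - by apply: mN; exact: weakly_measurable_comp.
  - by apply: measurable_funM => //; exact: mN.
  - by move=> w; rewrite sqr_ge0.
  - by move=> w; rewrite mulr_ge0// sqr_ge0.
  apply: aeW => w /=; rewrite -exprMn ler_pXn2r ?nnegrE//.
  by rewrite (le_trans _ (Tb (X w))).
move: X2; rewrite /square_integrable unlock => X2.
under eq_integral do rewrite EFinM.
rewrite ge0_integralZl_EFin ?sqr_ge0//; last first.
  by apply/measurable_EFinP; exact: mN.
by apply: lte_mul_pinfty; rewrite ?lee_fin ?sqr_ge0.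
Qed.

Lemma covariance_comp (X : Omega -> H) Sigma : weakly_measurable dot X ->
  is_covariance dot P X Sigma ->
  is_covariance dot P (T \o X) (T \o Sigma \o T).
Proof.
move=> mX cov x.
have -> : (fun w => tensor dot ((T \o X) w) ((T \o X) w) x) =
    T \o (fun w => tensor dot (X w) (X w) (T x)).
  by apply/funext => w /=; rewrite /tensor (self_adjointZ hn Ts) Ts.
apply: expectation_comp (cov (T x)) => u.
by under eq_fun do rewrite /tensor dotZl; exact: measurable_funM.
Qed.

Lemma independent_copies_comp X n (Xs : 'I_n -> Omega -> H) :
  independent_copies P X Xs ->
  independent_copies P (T \o X) (fun i => T \o Xs i).
Proof.
have cT := bounded_continuous hn Ts Tb.
have bT := borel_set_preimage cT.
move=> [mX eqX indX]; split.
- by move=> i; apply: random_element_comp.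
- by move=> i A mA; exact: (eqX i _ (bT _ mA)).
move=> A mA.
exact: (indX (fun i => T @^-1` A i) (fun i => bT _ (mA i))).
Qed.

End images.

(** * Deviation bounds *)

Section restricted_concentration.
Context {R : realType} (C1 C3 : R).
Hypothesis hC3 : 1 < C3.
Hypothesis hKL : covariance_concentration C1 C3.
Context {H : completeNormedModType R} (dot : {dot H for idfun}).
Context (dd : measure_display) (Omega : measurableType dd).
Variables (P : probability Omega R) (X : Omega -> H) (Sigma : H -> H).
Variables (p : option nat) (lam : nat -> R) (e : nat -> H).
Variables (n : nat) (Xs : 'I_n -> Omega -> H).
Hypothesis hn : induces_norm dot.
Hypothesis sepH : separable H.
Hypothesis mX : random_element X.
Hypothesis X0 : centered dot P X.
Hypothesis Xsg : sub_gaussian dot P C1 X.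
Hypothesis covX : is_covariance dot P X Sigma.
Hypothesis he : orthonormal_basis dot p e.
Hypothesis Se : forall k, in_dim p k -> Sigma (e k) = lam k *: e k.
Hypothesis lam0 : forall k, in_dim p k -> 0 < lam k.
Hypothesis lam1 : forall k, in_dim p k -> lam k <= lam 1.
Hypothesis n0 : (0 < n)%N.
Hypothesis copX : independent_copies P X Xs.

(* The concentration hypothesis is applied to [T X], where [T] is the inverse
   square root of [G] on the span of the [e k], [k] in [I], and [0] on its
   orthogonal complement. *)
Lemma restricted_concentration (I : pred nat) (g : nat -> R) (G : H -> H)
    (d : nat) (b y : R) (A : set Omega) :
  0 < y -> in_dim p d -> I d -> g d = y * lam d ->
  (forall k, in_dim p k -> I k -> y * lam d <= g k <= b) ->
  (forall k, in_dim p k -> I k -> lam k / g k <= y^-1) ->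
  diagonal dot p e g G ->
  (\sum_(1 <= k <oo | in_dim p k) (if I k then lam k / g k else 0)%:E
     <= (n%:R * y^-1 * Num.min (y / C3) ((y / C3) ^+ 2))%:E)%E ->
  measurable A ->
  (forall w, A w -> exists2 u, forall k, in_dim p k -> ~~ I k -> dot u (e k) = 0 &
    dot (G u) u < `|dot (Sigma u) u - dot (sample_covariance dot Xs w u) u|) ->
  (P A <= (expR (- (n%:R * Num.min (y / C3) ((y / C3) ^+ 2))))%:E)%E.
Proof.
move=> y0 dp Id gd gb lamg Gd tr mA hA.
have C30 : 0 < C3 by exact: lt_trans hC3.
have ld0 := lam0 dp.
have g0 k : in_dim p k -> I k -> 0 < g k.
  by move=> kp /(gb _ kp)/andP[+ _]; apply: lt_le_trans; rewrite mulr_gt0.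
(* [t] and [s] are the eigenvalues of [T] and of its inverse on the span. The lower bound
   [y * lam d] on [g] makes [T] bounded, the upper bound [b] makes [S] bounded. *)
pose t k := if I k then (Num.sqrt (g k))^-1 else 0.
pose s k := if I k then Num.sqrt (g k) else 0.
pose bt := (Num.sqrt (y * lam d))^-1.
have bt0 : 0 <= bt by rewrite invr_ge0 sqrtr_ge0.
have tb k : in_dim p k -> `|t k| <= bt.
  move=> kp; rewrite /t; case: ifP => Ik; last by rewrite normr0.
  have /andP[yg _] := gb k kp Ik.
  rewrite ger0_norm ?invr_ge0 ?sqrtr_ge0// lef_pV2 ?posrE ?sqrtr_gt0 ?g0//.
    by rewrite ler_sqrt// ltW// g0.
  by rewrite mulr_gt0.
have sb k : in_dim p k -> `|s k| <= Num.sqrt b.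
  move=> kp; rewrite /s; case: ifP => Ik; last by rewrite normr0 sqrtr_ge0.
  have /andP[_ gkb] := gb k kp Ik.
  by rewrite ger0_norm ?sqrtr_ge0// ler_sqrt// (le_trans _ gkb)// ltW// g0.
have [T Td] := diagonal_exists hn he tb.
have [S Sd] := diagonal_exists hn he sb.
have Ts := diagonal_self_adjoint hn he Td.
have Tb := diagonal_bounded hn he Td tb bt0.
have cT := bounded_continuous hn Ts Tb.
have Te k : in_dim p k -> T (e k) = t k *: e k.
  move=> kp; apply: (dot_basis_inj hn he) => j jp.
  rewrite Td// dotZl (dot_basis he)//.
  by case: eqP => [->|]; rewrite ?mulr0.
have Ss := covariance_self_adjoint covX.
have Sigd := self_adjoint_diagonal Ss Se.
have wX := random_element_weakly hn mX.
pose Sigma' := T \o Sigma \o T.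
have S'd : diagonal dot p e (fun k => if I k then lam k / g k else 0) Sigma'.
  move=> x k kp; rewrite /Sigma' /= Td// Sigd// Td// /t; case: ifP => Ik.
    have gk := g0 k kp Ik.
    rewrite -[in RHS](sqr_sqrtr (ltW gk)); field.
    by rewrite gt_eqF// sqrtr_gt0.
  by rewrite !mul0r.
have S'e k : in_dim p k -> Sigma' (e k) = (if I k then lam k / g k else 0) *: e k.
  move=> kp; apply: (dot_basis_inj hn he) => j jp.
  rewrite S'd// dotZl (dot_basis he)//.
  by case: eqP => [->|]; rewrite ?mulr0.
have lgd : lam d / g d = y^-1 by rewrite gd; field; rewrite !gt_eqF.
have ek0 k : in_dim p k -> e k != 0.
  by move=> kp; rewrite -normr_eq0 (norm_basis hn he)// oner_neq0.
(* The value [y^-1] is attained at [e d]. Any eigenvector has a nonzero coordinate, so its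
   eigenvalue is one of the diagonal entries, none of which exceeds [y^-1]. *)
have big : largest_eigenvalue Sigma' y^-1.
  split; first by exists (e d); [exact: ek0|rewrite S'e// Id lgd].
  move=> m [x x0 Sx]; rewrite leNgt; apply/negP => ym.
  move/eqP : x0; apply; apply: (dot_basis_inj hn he) => k kp.
  have := S'd x k kp; rewrite Sx dotZl dot0l => /eqP.
  rewrite -subr_eq0 -mulrBl mulf_eq0 subr_eq0 => /orP[/eqP mk|/eqP//].
  move: ym; rewrite mk; case: ifP => Ik; first by rewrite ltNge lamg.
  by rewrite ltNge invr_ge0 ltW.
have TX0 : centered dot P (T \o X).
  by rewrite /centered -[0](_ : T 0 = 0);
    [exact: (expectation_comp hn he Ts Tb)|
     rewrite -(scale0r (0 : H)) (self_adjointZ hn Ts) !scale0r].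
have TXs := independent_copies_comp hn Ts Tb copX.
have x0 : 0 < y / C3 by rewrite divr_gt0.
have trE : trace dot p e Sigma' =
    (\sum_(1 <= k <oo | in_dim p k) (if I k then lam k / g k else 0)%:E)%E.
  apply: eq_eseriesr => k kp; rewrite S'e// dotZl (dot_basis he)// eqxx.
  by rewrite mulr1.
rewrite -trE in tr.
have := @hKL H dot dd Omega P (T \o X) Sigma' p e y^-1 n (fun i => T \o Xs i)
  hn sepH (random_element_comp cT mX) TX0 (sub_gaussian_comp hn he Ts Tb wX Xsg)
  (covariance_comp hn he Ts Tb wX covX) he big n0 TXs (y / C3) x0 tr.
apply: le_trans; apply: le_measure; rewrite ?inE//.
  apply: (measurable_operator_norm_gt hn sepH (A := fun w u =>
    Sigma' u - sample_covariance dot (fun i => T \o Xs i) w u) _ he).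
  - move=> w u v; rewrite dotBl dotBr; congr (_ - _).
      by rewrite /Sigma' /= !Ts Ss Ts.
    exact: sample_covariance_self_adjoint.
  - move=> w; exists (y^-1 + n%:R^-1 * \sum_(i < n) `|T (Xs i w)| ^+ 2) => x.
    rewrite mulrDl (le_trans (ler_normB _ _))// lerD//.
      apply: (diagonal_bounded hn he S'd); last by rewrite invr_ge0 ltW.
      move=> k kp; case: ifP => Ik; last by rewrite normr0 invr_ge0 ltW.
      by rewrite ger0_norm ?lamg// divr_ge0// ltW ?lam0 ?g0.
    exact: (sample_covariance_bounded hn).
  - move=> u v; under eq_fun do rewrite dotBl.
    apply: measurable_funB => //.
    apply: sample_covariance_weakly => i; apply: (weakly_measurable_comp Ts).
    by apply: (random_element_weakly hn); case: copX.
move=> w Aw /=; have [u uI Gu] := hA w Aw.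
(* The test vector is [S u]: [T] sends it back to [u], and its squared norm is the form of [G] at
   [u]. *)
have TSu : T (S u) = u.
  apply: (dot_basis_inj hn he) => k kp; rewrite Td// Sd// /t /s.
  case: ifPn => Ik; last by rewrite mul0r uI.
  by rewrite mulKf// gt_eqF// sqrtr_gt0 g0.
have SuG : `|S u| ^+ 2 = dot (G u) u.
  have E k : in_dim p k ->
      dot (S u) (e k) * dot (S u) (e k) = dot (G u) (e k) * dot u (e k).
    move=> kp; rewrite Sd// Gd// /s; case: ifPn => Ik; last first.
      by rewrite uI// !mulr0.
    by rewrite mulrACA -expr2 sqr_sqrtr ?mulrA// ltW// g0.
  rewrite -hn; apply/eqP; rewrite eq_le.
  by apply/andP; split; apply: (le_parseval hn he) => k kp; rewrite E.
(* The choice [x = y / C3] normalizes the deviation threshold to 1. *)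
have -> : C3 * y^-1 * (y / C3) = 1 by field; rewrite !gt_eqF.
apply: (@operator_norm_gt _ _ _ hn _ _ _ (S u)) => //.
  move=> a v; rewrite dotBl dotBr; congr (_ - _).
    by rewrite /Sigma' /= !Ts Ss Ts.
  exact: sample_covariance_self_adjoint.
rewrite mul1r SuG dotBl (sample_covariance_comp hn)// /Sigma' /= TSu !Ts TSu.
exact: Gu.
Qed.

End restricted_concentration.

(** * Constants in the trace condition and in the exponent *)

Section numeric.
Context {R : realType} (C3 : R).
Hypothesis hC3 : 1 < C3.
Implicit Types (N y : R).

(** [y^-1] is the contribution of the index [d] to the trace, [s] that of the others. Each takes
    half of [N * min y 1 / C3 ^+ 2], and this fits the right side since [min y 1] is at most [y] and
    at most 1, which is below [C3]. *)
Lemma trace_budget N y s : 0 < N -> 0 < y ->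
  2 * C3 ^+ 2 <= N * Num.min y (y ^+ 2) ->
  s <= N * Num.min y 1 / (2 * C3 ^+ 2) ->
  y^-1 + s <= N * y^-1 * Num.min (y / C3) ((y / C3) ^+ 2).
Proof.
move=> N0 y0 hN hs.
have C30 : 0 < C3 by exact: lt_trans hC3.
have C32 : 0 < 2 * C3 ^+ 2 by rewrite mulr_gt0// exprn_gt0.
have minE : Num.min y (y ^+ 2) = y * Num.min y 1.
  by rewrite minC expr2 -{3}(mulr1 y) minr_pMr// ltW.
have hy : y^-1 <= N * Num.min y 1 / (2 * C3 ^+ 2).
  rewrite ler_pdivlMr// ler_pdivrMl//; move: hN; rewrite minE; lra.
apply: (le_trans (lerD hy hs)).
set m := Num.min y 1.
have m1 : m <= 1 by rewrite ge_min lexx orbT.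
have my : m <= y by rewrite ge_min lexx.
have -> : N * m / (2 * C3 ^+ 2) + N * m / (2 * C3 ^+ 2) = N * y^-1 * (y * (m / C3 ^+ 2)).
  by field; rewrite !gt_eqF.
rewrite ler_wpM2l ?mulr_ge0 ?invr_ge0 ?(ltW N0) ?(ltW y0)// le_min; apply/andP; split.
  rewrite ler_wpM2l ?(ltW y0)// ler_pdivrMr ?exprn_gt0// expr2 mulrA mulVf ?gt_eqF//.
  by rewrite mul1r (le_trans m1)// ltW.
by rewrite expr_div_n expr2 -mulrA ler_wpM2l ?(ltW y0)// ler_wpM2r// invr_ge0 sqr_ge0.
Qed.

(** As [C3 > 1], replacing [y] by [y / C3] divides either branch of the minimum by at most
    [C3 ^+ 2]. *)
Lemma tail_exponent N y : 0 < N -> 0 < y ->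
  expR (- (N * Num.min (y / C3) ((y / C3) ^+ 2))) <=
  expR (1 - (2 * C3 ^+ 2)^-1 * N * Num.min y (y ^+ 2)).
Proof.
move=> N0 y0; rewrite ler_expR.
have C30 : 0 < C3 by exact: lt_trans hC3.
suff : (2 * C3 ^+ 2)^-1 * Num.min y (y ^+ 2) <= Num.min (y / C3) ((y / C3) ^+ 2).
  move=> /(ler_wpM2l (ltW N0)); rewrite mulrA (mulrC N); lra.
have C32 : (C3 ^+ 2)^-1 <= C3^-1.
  by rewrite lef_pV2 ?posrE ?exprn_gt0// expr2 ler_peMl ?ltW.
have C3i : 0 < (C3 ^+ 2)^-1 by rewrite invr_gt0 exprn_gt0.
rewrite invfM le_min; set m := Num.min y (y ^+ 2).
have m0 : 0 <= m by rewrite le_min (ltW y0) sqr_ge0.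
have : 2^-1 * (C3 ^+ 2)^-1 * m <= (C3 ^+ 2)^-1 * m.
  by rewrite ler_wpM2r// ler_piMl ?(ltW C3i)// invf_le1 ?ler1n.
move=> hm; apply/andP; split; apply: (le_trans hm).
  by rewrite mulrC ler_pM ?(ltW C3i)// ge_min lexx.
by rewrite mulrC expr_div_n ler_wpM2r ?(ltW C3i)// ge_min lexx orbT.
Qed.

End numeric.

Lemma in_dim_le p d k : in_dim p d -> (0 < k <= d)%N -> in_dim p k.
Proof.
move=> /andP[d0 dp] /andP[k0 kd]; rewrite /in_dim k0 /=.
by case: p dp => // r; apply: leq_trans.
Qed.

(** * Min-max test vectors for a single eigenvalue *)

Section max_min.
Context {R : realType} {H : completeNormedModType R} (dot : {dot H for idfun}).
Hypothesis hn : induces_norm dot.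
Variables (p : option nat) (e : nat -> H) (d : nat).
Hypothesis he : orthonormal_basis dot p e.
Hypothesis dp : in_dim p d.
Variables (B : H -> H) (mu : nat -> R).
Hypothesis Bs : self_adjoint dot B.
Hypothesis Bmu : ordered_eigenvalues dot p B mu.

(** The span of the first [d] eigenvectors of [B], where the form is at least [mu d], contains a
    nonzero vector orthogonal to the [d - 1] vectors [e k], [k < d]. *)
Lemma ordered_eigenvalue_ge : exists2 u, u != 0 &
  (forall k, in_dim p k -> (k < d)%N -> dot u (e k) = 0) /\
  mu d * `|u| ^+ 2 <= dot (B u) u.
Proof.
have [f [hf Bf mono]] := Bmu.
case: d dp => [|m] mp; first by case/andP: mp.
have [u u0 [uf ue]] := exists_span_ortho hf e mp.
exists u => //; split=> [k kp km|].
  by apply: ue; move: km; rewrite ltnS => ->; case/andP: kp => ->.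
apply: (quad_ge hn hf (self_adjoint_diagonal Bs Bf)) => i ip.
by case: (leqP i m.+1) => im; [right; exact: mono|left; exact: uf].
Qed.

(** The same count with the two bases exchanged: [u] lies in the span of the first [d] vectors [e k]
    and avoids the first [d - 1] eigenvectors of [B]. *)
Lemma ordered_eigenvalue_le : exists2 u, u != 0 &
  (forall k, in_dim p k -> (d < k)%N -> dot u (e k) = 0) /\
  dot (B u) u <= mu d * `|u| ^+ 2.
Proof.
have [f [hf Bf mono]] := Bmu.
case: d dp => [|m] mp; first by case/andP: mp.
have [u u0 [ue uf]] := exists_span_ortho he f mp.
exists u => //; split=> //.
apply: (quad_le hn hf (self_adjoint_diagonal Bs Bf)) => i ip.
case: (ltnP i m.+1) => im; [left; apply: uf|right; exact: mono].
by move: im; rewrite ltnS => ->; case/andP: ip => ->.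
Qed.

End max_min.

(** Isolates the index [d], which belongs to the trace but not to the sums in the theorem. *)
Lemma nneseries_dim_split (R : realType) p d (f : nat -> R) : in_dim p d ->
  (forall k, in_dim p k -> 0 <= f k) ->
  (\sum_(1 <= k <oo | in_dim p k) (f k)%:E =
   (\sum_(1 <= k < d) f k)%:E + (f d)%:E
   + \sum_(d.+1 <= k <oo | in_dim p k) (f k)%:E)%E.
Proof.
move=> dp f0; have d0 : (0 < d)%N by case/andP: dp.
rewrite (nneseries_split_cond 1 d); last by move=> k kp; rewrite lee_fin f0.
rewrite add1n; congr (_ + _)%E.
rewrite big_mkcond big_nat_recr//= dp -sumEFin; congr (_ + _)%E.
rewrite big_nat [RHS]big_nat; apply: eq_bigr => k /andP[k0 kd].
by rewrite (in_dim_le dp)// k0 ltnW.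
Qed.

Theorem theorem2p15 (R : realType) (C1 C3 : R) (hC3 : 1 < C3)
    (hKL : covariance_concentration C1 C3) :
  exists2 c : R, 0 < c &
  forall (H : completeNormedModType R) (dot : {dot H for idfun})
    (dd : measure_display) (Omega : measurableType dd) (P : probability Omega R)
    (X : Omega -> H) (Sigma : H -> H) (p : option nat) (lam : nat -> R)
    (n : nat) (Xs : 'I_n -> Omega -> H) (lhat : nat -> Omega -> R) (d : nat),
  induces_norm dot -> separable H ->
  random_element X -> centered dot P X -> sub_gaussian dot P C1 X ->
  is_covariance dot P X Sigma ->
  ordered_eigenvalues dot p Sigma lam ->
  (forall k, in_dim p k -> 0 < lam k) ->
  (0 < n)%N -> independent_copies P X Xs ->
  (forall w, ordered_eigenvalues dot p (sample_covariance dot Xs w) (lhat ^~ w)) ->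
  (forall w k, in_dim p k -> 0 <= lhat k w) ->
  in_dim p d ->
  (forall y : R, 0 < y ->
     (((n%:R * Num.min y 1)^-1)%:E *
        \sum_(d.+1 <= k <oo | in_dim p k)
          (lam k / (lam d - lam k + y * lam d))%:E
      <= ((2 * C3 ^+ 2)^-1)%:E)%E ->
     (P [set w | (lhat d w - lam d > y * lam d)%R]
      <= (expR (1 - c * n%:R * Num.min y (y ^+ 2)))%:E)%E) /\
  (forall y : R, 0 < y ->
     (n%:R * Num.min y 1)^-1 *
        (\sum_(1 <= j < d) lam j / (lam j - lam d + y * lam d))
      <= (2 * C3 ^+ 2)^-1 ->
     (P [set w | (lhat d w - lam d < - (y * lam d))%R]
      <= (expR (1 - c * n%:R * Num.min y (y ^+ 2)))%:E)%E).
Proof.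
have C30 : 0 < C3 by exact: lt_trans hC3.
have C32 : 0 < 2 * C3 ^+ 2 by rewrite mulr_gt0// exprn_gt0.
(* With this [c], the exponent is nonnegative exactly when [n * min y (y ^+ 2)] is at most
   [2 * C3 ^+ 2], the threshold of the trivial case. *)
exists (2 * C3 ^+ 2)^-1; first by rewrite invr_gt0.
move=> H dot dd Omega P X Sigma p lam n Xs lhat d hn sepH mX X0 Xsg covX.
move=> [e [he Se mono]] lam0 n0 copX hl l0 dp.
have d0 : (0 < d)%N by case/andP: dp.
have N0 : 0 < n%:R :> R by rewrite ltr0n.
have ld0 := lam0 d dp.
have lam1 k : in_dim p k -> lam k <= lam 1%N.
  move=> kp; have k0 : (0 < k)%N by case/andP: kp.
  by apply: mono => //; apply: (in_dim_le kp).
have SCs := sample_covariance_self_adjoint dot Xs.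
have Ss := covariance_self_adjoint covX.
have mlhat : measurable_fun setT (lhat d).
  apply: (measurable_eigenvalue hn sepH SCs _ hl l0 dp) => u.
  apply: sample_covariance_weakly => i.
  by apply: (random_element_weakly hn); case: copX.
have trivial_case y A : 0 < y -> measurable A ->
    n%:R * Num.min y (y ^+ 2) < 2 * C3 ^+ 2 ->
    (P A <= (expR (1 - (2 * C3 ^+ 2)^-1 * n%:R * Num.min y (y ^+ 2)))%:E)%E.
  move=> y0 mA small; apply: (le_trans (probability_le1 P mA)).
  rewrite lee_fin -[leLHS]expR0 ler_expR subr_ge0 -mulrA mulrC ler_pdivrMr// mul1r.
  exact: ltW.
have conc := restricted_concentration hC3 hKL hn sepH mX X0 Xsg covX he Se lam0
  n0 copX.
have min0 (y : R) : 0 < y -> 0 < n%:R * Num.min y 1.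
  by move=> y0; rewrite mulr_gt0// lt_min y0 ltr01.
split=> y y0 hy.
  have mA : measurable [set w | lhat d w - lam d > y * lam d].
    by apply: measurable_ltr => //; exact: measurable_funB.
  case: (ltP (n%:R * Num.min y (y ^+ 2)) (2 * C3 ^+ 2)) => [|large].
    exact: trivial_case.
  have := tail_exponent hC3 N0 y0; rewrite -lee_fin; apply: le_trans.
  pose g k := lam d - lam k + y * lam d.
  pose I k := (d <= k)%N.
  have yg k : in_dim p k -> I k -> y * lam d <= g k.
    by move=> kp dk; rewrite lerDr subr_ge0 mono.
  have g0 k : in_dim p k -> I k -> 0 < g k.
    by move=> kp dk; rewrite (lt_le_trans _ (yg k kp dk))// mulr_gt0.
  apply: (conc I g (fun u => (lam d + y * lam d) *: u - Sigma u) d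
    (lam d + y * lam d)) => //.
  - exact: leqnn.
  - by rewrite /g subrr add0r.
  - move=> k kp dk; rewrite yg//= lerD2r gerBl ltW//; exact: lam0.
  - move=> k kp dk; rewrite ler_pdivrMr ?g0// ler_pdivlMl//.
    rewrite (le_trans _ (yg k kp dk))// ler_wpM2l ?(ltW y0)//.
    exact: mono.
  - move=> x k kp; rewrite dotBl dotZl (self_adjoint_diagonal Ss Se)// /g; ring.
  - rewrite (@nneseries_dim_split _ _ d)//; last first.
      by move=> k kp; case: ifP => Ik //; rewrite divr_ge0 ?ltW ?lam0 ?g0.
    rewrite big_nat big1 ?add0e; last first.
      by move=> k /andP[_ kd]; rewrite /I leqNgt kd.
    rewrite {1}/I leqnn.
    have -> : lam d / g d = y^-1 by rewrite /g subrr add0r; field; rewrite !gt_eqF.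
    set tail := (X in (_ + X <= _)%E).
    have tailE : tail = (\sum_(d.+1 <= k <oo | in_dim p k)
          (lam k / (lam d - lam k + y * lam d))%:E)%E.
      apply: congr_lim; apply/funext => N; rewrite big_nat_cond [RHS]big_nat_cond.
      by apply: eq_bigr => k /andP[/andP[dk _] kp]; rewrite /I (ltnW dk).
    have tail0 : (0 <= tail)%E.
      apply: nneseries_ge0 => k dk kp; rewrite lee_fin; case: ifP => Ik //.
      by rewrite divr_ge0 ?ltW ?lam0 ?g0.
    have tailb : (tail <= (n%:R * Num.min y 1 / (2 * C3 ^+ 2))%:E)%E.
      move: hy; rewrite -tailE lee_pdivrMl ?min0//.
    (* The condition on [y] forces the series to be finite, so that the real inequality
       [trace_budget] applies. *)
    have tailfin : tail \is a fin_num.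
      by rewrite ge0_fin_numE// (le_lt_trans tailb)// ltry.
    rewrite -(fineK tailfin) -EFinD lee_fin.
    apply: trace_budget => //.
    by rewrite -lee_fin fineK.
  move=> w /= Aw.
  (* At this [u] the sample form exceeds [(1 + y) * lam d * |u|^2]; subtracting the form of [Sigma]
     leaves that of [G] on the other side. *)
  have [u u0 [ue uq]] := ordered_eigenvalue_ge hn e dp (SCs w) (hl w).
  exists u; first by move=> k kp; rewrite /I -ltnNge; exact: ue.
  have uu : 0 < `|u| ^+ 2 by rewrite exprn_gt0// normr_gt0.
  rewrite distrC; apply: lt_le_trans (ler_norm _).
  rewrite dotBl dotZl ltrD2r hn; apply: lt_le_trans uq.
  by rewrite ltr_pM2r// addrC -ltrBrDr.
have mA : measurable [set w | lhat d w - lam d < - (y * lam d)].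
  by apply: measurable_ltr => //; exact: measurable_funB.
(* For [y >= 1] the event would make [lhat d w] negative, so it is empty. *)
case: (ltP y 1) => y1; last first.
  rewrite (_ : [set _ | _] = set0) ?measure0 ?lee_fin ?expR_ge0//.
  apply/seteqP; split => // w /=; apply/negP; rewrite -leNgt.
  rewrite (@le_trans _ _ (- lam d))//; last by rewrite lerBrDr addNr l0.
  by rewrite lerN2 ler_peMl// ltW.
case: (ltP (n%:R * Num.min y (y ^+ 2)) (2 * C3 ^+ 2)) => [|large].
  exact: trivial_case.
have := tail_exponent hC3 N0 y0; rewrite -lee_fin; apply: le_trans.
pose g k := lam k - lam d + y * lam d.
pose I k := (k <= d)%N.
have yg k : in_dim p k -> I k -> y * lam d <= g k.
  by move=> kp dk; rewrite lerDr subr_ge0 mono.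
have g0 k : in_dim p k -> I k -> 0 < g k.
  by move=> kp dk; rewrite (lt_le_trans _ (yg k kp dk))// mulr_gt0.
apply: (conc I g (fun u => Sigma u - (lam d - y * lam d) *: u) d
  (lam 1%N + y * lam d)) => //.
- exact: leqnn.
- by rewrite /g subrr add0r.
- move=> k kp dk; rewrite yg//= lerD2r (le_trans _ (lam1 k kp))//.
  by rewrite gerBl ltW.
- move=> k kp dk; rewrite ler_pdivrMr ?g0// ler_pdivlMl// /g.
  (* This product equals [g k - y * lam k]; here [y < 1] is used. *)
  have : 0 <= (1 - y) * (lam k - lam d).
    by rewrite mulr_ge0 ?subr_ge0 ?mono// ltW.
  lra.
- move=> x k kp; rewrite dotBl dotZl (self_adjoint_diagonal Ss Se)// /g; ring.
- rewrite (@nneseries_dim_split _ _ d)//; last first.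
    by move=> k kp; case: ifP => Ik //; rewrite divr_ge0 ?ltW ?lam0 ?g0.
  rewrite eseries0 ?adde0; last first.
    by move=> k dk kp; rewrite /I leqNgt dk.
  rewrite {2}/I leqnn -EFinD lee_fin addrC.
  have -> : lam d / g d = y^-1 by rewrite /g subrr add0r; field; rewrite !gt_eqF.
  apply: trace_budget => //; move: hy; rewrite ler_pdivrMl ?min0//.
  apply: le_trans; rewrite le_eqVlt big_nat [X in _ == X]big_nat.
  apply/orP; left; apply/eqP.
  by apply: eq_bigr => k /andP[_ kd]; rewrite /I (ltnW kd).
move=> w /= Aw.
have [u u0 [ue uq]] := ordered_eigenvalue_le hn he dp (SCs w) (hl w).
exists u; first by move=> k kp; rewrite /I -ltnNge; exact: ue.
have uu : 0 < `|u| ^+ 2 by rewrite exprn_gt0// normr_gt0.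
apply: lt_le_trans (ler_norm _).
rewrite dotBl dotZl ltrD2l ltrN2 hn; apply: (le_lt_trans uq).
by rewrite ltr_pM2r// addrC -ltrBlDr.
Qed.
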